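(* Let $n\ge 1$, $\sigma>0$, $\tau\in\mathbb{R}$, let $\mathcal{A}:\mathbb{R}^n\to\mathbb{R}^n$ be a measurable (saliency map) function, and let $\boldsymbol{s},\boldsymbol{s}^{\rm ref}\in\mathbb{R}^n$ be fixed. Let $\boldsymbol{X}\sim N(\boldsymbol{s},\sigma^2 I_n)$ and $\boldsymbol{X}^{\rm ref}\sim N(\boldsymbol{s}^{\rm ref},\sigma^2 I_n)$ be independent. Let $M\subseteq\{1,\dots,n\}$ be a nonempty (observed) salient region with $\mathbb{P}(\mathcal{M}_{\boldsymbol{X}}=M)>0$. Consider either of the following two cases: (i) (mean null test) the null hypothesis ${\rm H}_0:\ \frac1{|M|}\sum_{i\in M}s_i=\frac1{|M|}\sum_{i\in M}s^{\rm ref}_i$ holds, and $T$ and $\mathcal{Q}$ are those of the mean null test; (ii) (global null test) the null hypothesis ${\rm H}_0:\ s_i=s^{\rm ref}_i$ for all $i\in M$ holds, and $T$ and $\mathcal{Q}$ are those of the global null test. Then the selective $p$-value $p_{\rm selective}$ satisfies $$\mathbb{P}_{{\rm H}_0}\big(p_{\rm selective}\le\alpha\ \big|\ \mathcal{M}_{\boldsymbol{X}}=M\big)=\alpha\qquad\text{for all }\alpha\in[0,1].$$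
   Context: The salient region of $\boldsymbol{x}\in\mathbb{R}^n$ is $\mathcal{M}_{\boldsymbol{x}}=\{i\in\{1,\dots,n\}:\mathcal{A}_i(\boldsymbol{x})\ge\tau\}$. For $M\subseteq\{1,\dots,n\}$, $\mathbf{1}^n_M\in\mathbb{R}^n$ is the indicator vector of $M$. Write $\binom{\boldsymbol{x}}{\boldsymbol{x}'}\in\mathbb{R}^{2n}$ for the stacked vector, and $\|\cdot\|$ for the Euclidean norm. Mean null test: $\boldsymbol{\eta}_M=\frac1{|M|}\binom{\mathbf{1}^n_M}{-\mathbf{1}^n_M}\in\mathbb{R}^{2n}$; test statistic $T(\boldsymbol{x},\boldsymbol{x}')=\boldsymbol{\eta}_{\mathcal{M}_{\boldsymbol{x}}}^\top\binom{\boldsymbol{x}}{\boldsymbol{x}'}$; nuisance statistic $\mathcal{Q}_{\boldsymbol{x},\boldsymbol{x}'}=\Big(I_{2n}-\frac{\boldsymbol{\eta}_{\mathcal{M}_{\boldsymbol{x}}}\boldsymbol{\eta}_{\mathcal{M}_{\boldsymbol{x}}}^\top}{\|\boldsymbol{\eta}_{\mathcal{M}_{\boldsymbol{x}}}\|^2}\Big)\binom{\boldsymbol{x}}{\boldsymbol{x}'}$. Global null test: $P_M=\frac12\begin{pmatrix}\mathrm{diag}(\mathbf{1}^n_M)&-\mathrm{diag}(\mathbf{1}^n_M)\\-\mathrm{diag}(\mathbf{1}^n_M)&\mathrm{diag}(\mathbf{1}^n_M)\end{pmatrix}$ (an orthogonal projection matrix) and $P_M^\perp=I_{2n}-P_M$;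 test statistic $T(\boldsymbol{x},\boldsymbol{x}')=\sigma^{-1}\big\|P_{\mathcal{M}_{\boldsymbol{x}}}\binom{\boldsymbol{x}}{\boldsymbol{x}'}\big\|$; nuisance statistic $\mathcal{Q}_{\boldsymbol{x},\boldsymbol{x}'}=(\mathcal{V}_{\boldsymbol{x},\boldsymbol{x}'},\mathcal{U}_{\boldsymbol{x},\boldsymbol{x}'})$ with $\mathcal{V}_{\boldsymbol{x},\boldsymbol{x}'}=\sigma P_{\mathcal{M}_{\boldsymbol{x}}}\binom{\boldsymbol{x}}{\boldsymbol{x}'}\big/\big\|P_{\mathcal{M}_{\boldsymbol{x}}}\binom{\boldsymbol{x}}{\boldsymbol{x}'}\big\|$ and $\mathcal{U}_{\boldsymbol{x},\boldsymbol{x}'}=P_{\mathcal{M}_{\boldsymbol{x}}}^\perp\binom{\boldsymbol{x}}{\boldsymbol{x}'}$ (the case of zero denominator has probability zero given $\mathcal{M}_{\boldsymbol{X}}=M$ and may be ignored). Selective $p$-value: for observed data $(\boldsymbol{x},\boldsymbol{x}')$ with $\mathcal{M}_{\boldsymbol{x}}=M$, $$p_{\rm selective}(\boldsymbol{x},\boldsymbol{x}')=\mathbb{P}_{{\rm H}_0}\Big(|T(\boldsymbol{X},\boldsymbol{X}^{\rm ref})|\ge|T(\boldsymbol{x},\boldsymbol{x}')|\ \Big|\ \mathcal{M}_{\boldsymbol{X}}=M,\ \mathcal{Q}_{\boldsymbol{X},\boldsymbol{X}^{\rm ref}}=\mathcal{Q}_{\boldsymbol{x},\boldsymbol{x}'}\Big),$$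 understood via a regular conditional distribution of $T(\boldsymbol{X},\boldsymbol{X}^{\rm ref})$ given $\mathcal{Q}_{\boldsymbol{X},\boldsymbol{X}^{\rm ref}}$ under the probability measure $\mathbb{P}(\,\cdot\mid\mathcal{M}_{\boldsymbol{X}}=M)$. In the claim, $p_{\rm selective}$ denotes the random variable $p_{\rm selective}(\boldsymbol{X},\boldsymbol{X}^{\rm ref})$ on the event $\mathcal{M}_{\boldsymbol{X}}=M$. *)

(* Defs.v *)
From HB Require Import structures.
From mathcomp Require Import all_boot all_order all_algebra.
From mathcomp Require Import all_classical all_reals all_analysis.

Set Implicit Arguments.
Unset Strict Implicit.
Unset Printing Implicit Defensive.

Import Order.TTheory GRing.Theory Num.Theory.
Import numFieldNormedType.Exports.

Local Open Scope classical_set_scope.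
Local Open Scope ring_scope.

(* Column vectors carry the sigma-algebra generated by the coordinates, as
   n.-tuple T does in MathComp-Analysis. Over a realType it is the Borel
   sigma-algebra of R^n. *)
Definition measure_cV_display : measure_display -> measure_display.
Proof. exact. Qed.

Section measurable_cV.
Context {d : measure_display} {T : sigmaRingType d}.
Variable n : nat.

Let coors : 'I_n -> 'cV[T]_n -> T := fun i x => x i 0.

Let cV_set0 : g_sigma_preimage coors set0.
Proof. exact: sigma_algebra0. Qed.

Let cV_setC A : g_sigma_preimage coors A -> g_sigma_preimage coors (~` A).
Proof. exact: sigma_algebraC. Qed.

Let cV_bigcup (F : _^nat) : (forall i, g_sigma_preimage coors (F i)) ->
  g_sigma_preimage coors (\bigcup_i (F i)).
Proof. exact: sigma_algebra_bigcup. Qed.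

HB.instance Definition _ := @isMeasurable.Build (measure_cV_display d)
  'cV[T]_n (g_sigma_preimage coors) cV_set0 cV_setC cV_bigcup.

Lemma measurable_coor (i : 'I_n) :
  measurable_fun [set: 'cV[T]_n] (fun x : 'cV[T]_n => x i 0).
Proof.
move=> _ Y mY; rewrite setTI; apply: sub_sigma_algebra => /=.
rewrite -bigcup_seq/=; exists i => /=; first by rewrite mem_index_enum.
by exists Y => //; rewrite setTI.
Qed.

End measurable_cV.

(* MathComp-Analysis equips matrices with the sup norm, hence this definition. *)
Definition euclidean_norm (R : realType) (n : nat) (x : 'cV[R]_n) : R :=
  Num.sqrt (\sum_(i < n) x i 0 ^+ 2).

Section probability_notions.
Context (R : realType) (d : measure_display) (Omega : measurableType d).

(* X ~ N(s, sigma^2 I_n): the law of X is the product of the N(s_i, sigma^2),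
   i.e. the coordinates of X are mutually independent with these marginals.
   The second parameter of normal_prob is the standard deviation. *)
Definition isotropic_normal (P : probability Omega R) (n : nat)
    (X : Omega -> 'cV[R]_n) (s : 'cV[R]_n) (sigma : R) : Prop :=
  forall B : 'I_n -> set R, (forall i, measurable (B i)) ->
    P [set w | forall i, B i (X w i 0)] =
      (\prod_(i < n) normal_prob (s i 0)%R sigma (B i))%E.

Definition independent_pair (P : probability Omega R)
    (d1 d2 : measure_display) (T1 : measurableType d1) (T2 : measurableType d2)
    (X : Omega -> T1) (Y : Omega -> T2) : Prop :=
  forall (B : set T1) (C : set T2), measurable B -> measurable C ->
    P (X @^-1` B `&` Y @^-1` C) = (P (X @^-1` B) * P (Y @^-1` C))%E.

(* P( . | E) as a probability measure: A |-> P (A `&` E) / P E when P E != 0;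
   when P E = 0, mnormalize falls back on P. *)
Definition cond_probability (P : probability Omega R) (E : set Omega)
    (mE : measurable E) : probability Omega R :=
  mnormalize (mrestr P mE) P.

(* kappa is a regular conditional distribution of Y given Z: kappa is a
   probability kernel and kappa (Z w) C is a version of P(Y \in C | Z). *)
Definition regular_cond_distribution (P : probability Omega R)
    (dZ dY : measure_display) (TZ : measurableType dZ) (TY : measurableType dY)
    (Z : Omega -> TZ) (Y : Omega -> TY) (kappa : R.-pker TZ ~> TY) : Prop :=
  forall (B : set TZ) (C : set TY), measurable B -> measurable C ->
    (\int[P]_(w in Z @^-1` B) kappa (Z w) C)%E = P (Z @^-1` B `&` Y @^-1` C).

End probability_notions.

(* P(|T| >= |t| | Q = q), where kappa is a conditional distribution of the test
   statistic T given the nuisance statistic Q. *)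
Definition selective_pvalue (R : realType) (dQ : measure_display)
    (TQ : measurableType dQ) (kappa : R.-pker TQ ~> R) (q : TQ) (t : R) :
    \bar R :=
  kappa q [set u : R | `|t| <= `|u|].

Section selective_tests.
Context (R : realType) (n : nat).
Implicit Types (A : 'cV[R]_n -> 'cV[R]_n) (M : {set 'I_n}) (x xref : 'cV[R]_n).

Definition salient_region A (tau : R) x : {set 'I_n} :=
  [set i | tau <= A x i 0]%SET.

Definition indicator_vector M : 'cV[R]_n := \col_i (i \in M)%:R.

Definition eta_mean M : 'cV[R]_(n + n) :=
  #|M|%:R^-1 *: col_mx (indicator_vector M) (- indicator_vector M).

Definition mean_null M (s sref : 'cV[R]_n) : Prop :=
  #|M|%:R^-1 * (\sum_(i in M) s i 0) = #|M|%:R^-1 * (\sum_(i in M) sref i 0).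

Definition mean_statistic A (tau : R) x xref : R :=
  ((eta_mean (salient_region A tau x))^T *m col_mx x xref) 0 0.

Definition mean_nuisance A (tau : R) x xref : 'cV[R]_(n + n) :=
  let eta := eta_mean (salient_region A tau x) in
  (1%:M - (euclidean_norm eta ^+ 2)^-1 *: (eta *m eta^T)) *m col_mx x xref.

Definition projection_global M : 'M[R]_(n + n) :=
  let D := diag_mx (indicator_vector M)^T in
  2^-1 *: block_mx D (- D) (- D) D.

Definition global_null M (s sref : 'cV[R]_n) : Prop :=
  forall i, i \in M -> s i 0 = sref i 0.

Definition global_statistic A (tau sigma : R) x xref : R :=
  sigma^-1 *
    euclidean_norm (projection_global (salient_region A tau x) *m col_mx x xref).

(* When the projected vector vanishes, the direction component is 0 because
   0^-1 = 0 in R. *)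
Definition global_nuisance A (tau sigma : R) x xref :
    ('cV[R]_(n + n) * 'cV[R]_(n + n))%type :=
  let P := projection_global (salient_region A tau x) in
  let z := col_mx x xref in
  ((sigma / euclidean_norm (P *m z)) *: (P *m z), (1%:M - P) *m z).

End selective_tests.

Definition salient_event (R : realType) (n : nat) (Omega : Type)
    (A : 'cV[R]_n -> 'cV[R]_n) (tau : R) (X : Omega -> 'cV[R]_n)
    (M : {set 'I_n}) : set Omega :=
  [set w | salient_region A tau (X w) = M].

Lemma measurable_salient_event (R : realType) (n : nat)
    (d : measure_display) (Omega : measurableType d)
    (A : {mfun 'cV[R]_n >-> 'cV[R]_n}) (tau : R)
    (X : {mfun Omega >-> 'cV[R]_n}) (M : {set 'I_n}) :
  measurable (salient_event A tau X M).
Proof.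
have -> : salient_event A tau X M =
    \bigcap_(i in [set: 'I_n])
      [set w | (tau <= A (X w) i 0) = (i \in M)].
  apply/seteqP; split => [w /= <- i _ /=|w /= h].
    by rewrite inE.
  by apply/setP => i; rewrite inE; exact: h.
apply: fin_bigcap_measurable => // i _.
have mf : measurable_fun [set: Omega] (fun w => A (X w) i 0).
  apply: (measurableT_comp (@measurable_coor _ _ n i)).
  exact: measurableT_comp.
have mI : measurable [set w | tau <= A (X w) i 0].
  rewrite -[X in measurable X]setTI.
  have -> : [set w | tau <= A (X w) i 0] =
      (fun w => A (X w) i 0) @^-1` `[tau, +oo[.
    by apply/seteqP; split => w /=; rewrite in_itv/= andbT.
  exact: mf.
case: (i \in M) => //.
rewrite (_ : mkset _ = ~` [set w | tau <= A (X w) i 0]); first exact: measurableC.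
by apply/seteqP; split => w /=; case: (tau <= _).
Qed.

(* Main.v *)
Require Import Defs.
From HB Require Import structures.
From mathcomp Require Import all_boot all_order all_algebra.
From mathcomp Require Import all_classical all_reals all_analysis.
From mathcomp Require Import measurable_realfun ring.

Set Implicit Arguments.
Unset Strict Implicit.
Unset Printing Implicit Defensive.

Import Order.TTheory GRing.Theory Num.Theory.
Import numFieldNormedType.Exports.

Local Open Scope classical_set_scope.
Local Open Scope ring_scope.

(* The p-value is uniform as soon as P(|T| = g(Q)) = 0 for every measurable g.
   Indeed, for 0 < alpha < 1, let c(q) be the largest c such that
   kappa q {u | c <= |u|} >= alpha. Then c is measurable, and {p <= alpha} is
   {|T| > c(Q)} up to a subset of the graph {|T| = c(Q)}. Disintegration bounds
   P(|T| > c(Q)) by alpha from above and P(|T| >= c(Q)) by alpha from below.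

   It remains to see that Z = (X, Xref) almost surely avoids the set
   N = {|T_M| = g(Q_M)}, for M fixed. A one-parameter group psi_t of affine maps
   leaves Q_M invariant and moves T_M strictly: translations along eta_M for the
   mean test, the dilations z + (e^t - 1) P_M z for the global test. Hence each
   orbit meets N for finitely many t only (outside of a null set for the global
   test), so by Fubini P(psi_t Z \in N) = 0 for some t. Each psi_t is a product
   of coordinate-wise affine changes, which map laws of Gaussian vectors with
   independent coordinates to equivalent ones; applying psi_(-t) gives
   P(Z \in N) = 0. *)

(** * Column vectors and null sets of the line *)

Lemma measurable_fun_cV d (T : measurableType d) n d' (S : measurableType d')
    (f : S -> 'cV[T]_n) :
  (forall i, measurable_fun setT (fun x => f x i 0)) -> measurable_fun setT f.
Proof.
move=> mf; apply: measurability => //= _ [B + <-].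
rewrite setTI -bigcup_seq => -[i _ [C mC <-]].
rewrite setTI -[X in measurable X]setTI.
exact: (mf i _ C mC).
Qed.

Definition cV_boxes d (T : measurableType d) n : set (set 'cV[T]_n) :=
  [set C | exists2 B : 'I_n -> set T, (forall i, measurable (B i)) &
    C = [set x : 'cV[T]_n | forall i, B i (x i 0)]].

Arguments cV_boxes {d} T n _ : simpl never.

Lemma measurable_cV_box d (T : measurableType d) n (B : 'I_n -> set T) :
  (forall i, measurable (B i)) ->
  measurable [set x : 'cV[T]_n | forall i, B i (x i 0)].
Proof.
move=> mB; rewrite (_ : mkset _ = \bigcap_(i in [set: 'I_n])
    (fun x : 'cV[T]_n => x i 0) @^-1` B i).
  apply: fin_bigcap_measurable => // i _; rewrite -[X in measurable X]setTI.
  exact: measurable_coor.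
by apply/seteqP; split => x h i //=; exact: h.
Qed.

Lemma measurable_cV_boxE d (T : measurableType d) n :
  @measurable _ 'cV[T]_n = <<s cV_boxes T n >>.
Proof.
apply/seteqP; split; last first.
  apply: smallest_sub; first exact: sigma_algebra_measurable.
  by move=> _ [B mB ->]; exact: measurable_cV_box.
apply: smallest_sub; first exact: smallest_sigma_algebra.
move=> A; rewrite -bigcup_seq => -[i _ [C mC <-]].
apply: sub_sigma_algebra; exists (fun j => if j == i then C else setT).
  by move=> j; case: ifP.
apply/seteqP; split => [x [_ Cx] j|x /(_ i)/=]; last by rewrite eqxx.
by case: eqP => // ->.
Qed.

(** Measurable boxes form a pi-system that generates the sigma-algebra and contains the whole space.
    As [m1] is finite, the constant sequence [setT] serves as the exhaustion. *)
Lemma cV_measure_unique (R : realType) d (T : measurableType d) n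
    (m1 m2 : {measure set 'cV[T]_n -> \bar R}) :
  (m1 setT < +oo)%E ->
  (forall B : 'I_n -> set T, (forall i, measurable (B i)) ->
    m1 [set x : 'cV[T]_n | forall i, B i (x i 0)] =
    m2 [set x : 'cV[T]_n | forall i, B i (x i 0)]) ->
  forall A, measurable A -> m1 A = m2 A.
Proof.
move=> m1T m12 A mA.
have boxI : setI_closed (cV_boxes T n).
  move=> _ _ [B mB ->] [C mC ->]; exists (fun i => B i `&` C i).
    by move=> i; exact: measurableI.
  apply/seteqP; split => [x [h1 h2] i|x h].
    by split; [exact: h1|exact: h2].
  by split => i; have [] := h i.
have boxT (k : nat) : cV_boxes T n setT.
  by exists (fun=> setT) => //; apply/seteqP; split.
apply: (measure_unique _ (fun=> setT) (@measurable_cV_boxE _ T n) boxI boxT) => //.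
- by rewrite bigcup_const.
- by move=> _ [B mB ->]; exact: m12.
Qed.

Definition set_coor (T : Type) n (j : 'I_n) (z : 'cV[T]_n) (a : T) : 'cV[T]_n :=
  \col_i (if i == j then a else z i 0).

Lemma measurable_set_coor d (T : measurableType d) n (j : 'I_n) d'
    (S : measurableType d') (f : S -> 'cV[T]_n) (g : S -> T) :
  measurable_fun setT f -> measurable_fun setT g ->
  measurable_fun setT (fun x => set_coor j (f x) (g x)).
Proof.
move=> mf mg; apply: measurable_fun_cV => i.
under eq_fun do rewrite mxE.
case: eqP => // _.
exact: (measurableT_comp (@measurable_coor _ _ n i)).
Qed.

Definition image_measure d1 d2 (T1 : measurableType d1) (T2 : measurableType d2)
    (R : realFieldType) (m : {measure set T1 -> \bar R}) (f : T1 -> T2)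
    (mf : measurable_fun setT f) : {measure set T2 -> \bar R} :=
  measure_function_pushforward__canonical__measure_function_Measure m mf.

Section normal_lebesgue.
Variable R : realType.
Local Notation mu := (@lebesgue_measure R).

(** The normal density is positive everywhere, so its integral over [A] vanishes only if [A] lies in
    a Lebesgue null set. *)
Lemma lebesgue_dominates_normal (m s : R) (A : set (measurableTypeR R)) : 0 < s ->
  measurable A -> normal_prob m s A = 0%E -> mu A = 0%E.
Proof.
move=> s0 mA; rewrite /normal_prob => A0.
have mf : measurable_fun A (EFin \o normal_pdf m s).
  by apply/measurable_EFinP/measurable_funTS; exact: measurable_normal_pdf.
have /(ae_eq_integral_abs mu mA mf) :
    (\int[mu]_(x in A) `|(normal_pdf m s x)%:E| = 0)%E.
  rewrite -A0; apply: eq_integral => x _.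
  by rewrite gee0_abs// lee_fin normal_pdf_ge0.
move=> [N [mN N0 sN]].
have AN : A `<=` N; last exact: (subset_measure0 mA mN AN N0).
move=> x Ax; apply: sN => /= /(_ Ax) /eqP.
rewrite eqe gt_eqF// normal_pdfE ?gt_eqF//.
by rewrite mulr_gt0 ?normal_peak_gt0 ?gt_eqF// expR_gt0.
Qed.

(** The image of Lebesgue measure under x -> c x + b, multiplied by c, agrees with Lebesgue measure
    on half-open intervals, hence everywhere. *)
Lemma lebesgue_null_affine (c b : R) (A : set (measurableTypeR R)) : 0 < c ->
  measurable A -> mu A = 0%E -> mu [set x | A (c * x + b)] = 0%E.
Proof.
move=> c0 mA A0.
pose f := fun x : measurableTypeR R => (c * x + b : measurableTypeR R).
have mf : measurable_fun setT f.
  by apply: measurable_funD => //; exact: measurable_funM.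
pose nu : {measure set (measurableTypeR R) -> \bar R} :=
  mscale (NngNum (ltW c0)) (image_measure mu mf).
have nuE : forall X, measurable X -> mu X = nu X.
  apply: lebesgue_measure_unique => _ [[x y] _ <-].
  rewrite /nu /= /mscale/= /pushforward.
  have -> : f @^-1` `]x, y] = [set` `](x - b) / c, (y - b) / c]].
    apply/funext => z; rewrite /preimage/= !in_itv/= ltr_pdivrMr// ler_pdivlMr//.
    by rewrite [z * c]mulrC ltrBlDr lerBrDr.
  rewrite !lebesgue_measure_itv/= !lte_fin.
  rewrite ltr_pM2r ?invr_gt0// ltrD2r; case: ifP => _; last by rewrite mule0.
  by rewrite -!EFinB -EFinM; congr EFin; field; rewrite gt_eqF.
have := nuE A mA; rewrite A0 => /esym/eqP.
by rewrite /nu/= /mscale/= mule_eq0 eqe gt_eqF//= => /eqP.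
Qed.

End normal_lebesgue.

(** * Null-preserving maps of a Gaussian vector *)

Section null_product.
Local Open Scope ereal_scope.
Context d1 d2 (T1 : measurableType d1) (T2 : measurableType d2) (R : realType).
Variables (m1 : probability T1 R) (m2 : probability T2 R).
Implicit Types S : set (T1 * T2).

(** Tonelli: the product measure integrates the nonnegative section measures, and such an integral
    is 0 exactly when the integrand is 0 almost everywhere. *)
Lemma product_null_ae S : measurable S ->
  (m1 \x m2) S = 0 <-> {ae m1, forall x, m2 (xsection S x) = 0}.
Proof.
move=> mS.
have mf : measurable_fun setT (m2 \o xsection S).
  exact: measurable_fun_xsection.
have := ae_eq_integral_abs m1 measurableT mf.
under eq_integral do rewrite gee0_abs//.
move=> h; split.
  move=> /h; apply: filterS => x; exact.
by move=> h0; apply/h; apply: filterS h0 => x + _.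
Qed.

Lemma product_null_exists S : measurable S -> (m1 \x m2) S = 0 ->
  exists y, m1 (ysection S y) = 0.
Proof.
move=> mS S0.
have S0' : (m1 \x^ m2) S = 0.
  rewrite -S0; apply/esym; apply: product_measure_unique => //= A B mA mB.
  by rewrite product_measure2E.
have mf : measurable_fun setT (m1 \o ysection S).
  exact: measurable_fun_ysection.
have := ae_eq_integral_abs m2 measurableT mf.
under eq_integral do rewrite gee0_abs//.
move=> [+ _] => /(_ S0') [N [mN N0 sN]].
(* If every section had positive mass, the exceptional null set would be the whole space, which has
   mass 1. *)
apply: contrapT => /forallNP h.
have NT : N = setT.
  by rewrite -subTset => y _; apply: sN => /= /(_ I); exact: h.
have := probability_setT m2.
by rewrite -NT => N1; move: N0; rewrite /= N1 => /eqP; rewrite onee_eq0.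
Qed.

End null_product.

Section resampling.
Context (R : realType) (d : measure_display) (Omega : measurableType d).
Variables (P : probability Omega R) (n : nat) (Z : Omega -> 'cV[R]_n).
Variables (m : 'cV[R]_n) (sigma : R).
Hypothesis (mZ : measurable_fun setT Z) (sigma_gt0 : 0 < sigma).
Hypothesis (hZ : isotropic_normal P Z m sigma).

Let nu (j : 'I_n) : probability (measurableTypeR R) R :=
  normal_prob (m j 0) sigma.

Let resample j (x : Omega * measurableTypeR R) : 'cV[R]_n :=
  set_coor j (Z x.1) x.2.

Let mresample j : measurable_fun setT (resample j).
Proof. by apply: measurable_set_coor => //; exact: measurableT_comp. Qed.

(** Coordinate j is independent of the others, so redrawing it from its marginal does not change the
    law of [Z]. This makes coordinate j an explicit integration variable. *)
Lemma resampleE j (N : set 'cV[R]_n) : measurable N ->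
  P (Z @^-1` N) = (P \x nu j)%E (resample j @^-1` N).
Proof.
move=> mN.
apply: (@cV_measure_unique _ _ _ _ (image_measure P mZ)
  (image_measure (P \x nu j)%E (mresample j))) => //.
  have PT : (P setT < +oo)%E by rewrite probability_setT ltry.
  exact: PT.
move=> B mB.
(* The box [B'] leaves coordinate j of [Z] free; its constraint passes to the redrawn value. *)
pose B' i := if i == j then setT else B i.
have mB' i : measurable (B' i) by rewrite /B'; case: ifP.
transitivity (P [set w | forall i, B i (Z w i 0)]) => //.
transitivity ((P \x nu j)%E ([set w | forall i, B' i (Z w i 0)] `*` B j)).
  transitivity ((\prod_i normal_prob (m i 0)%R sigma (B' i)) * nu j (B j))%E.
    rewrite [LHS](hZ mB) (bigD1 j)//= [in RHS](bigD1 j)//= /B' eqxx.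
    rewrite [normal_prob _ _ setT](probability_setT (nu j)) mul1e muleC.
    by congr (_ * _)%E; apply: eq_bigr => i /negPf ->.
  rewrite -(hZ mB') product_measure1E//.
    have := mZ measurableT (measurable_cV_box mB').
    by rewrite setTI.
  exact: mB.
congr ((P \x nu j)%E _); apply/seteqP; split => -[w a] /=.
  move=> [h Ba] i; rewrite /resample mxE/=; case: eqP => [->//|/eqP/negPf ij].
  by have := h i; rewrite /B' ij.
move=> h; split => [i|].
  rewrite /B'; case: eqP => // /eqP/negPf ij.
  by have := h i; rewrite /resample mxE/= ij.
by have := h j; rewrite /resample mxE/= eqxx.
Qed.

(** Absolute continuity of the law of [phi \o Z] with respect to the law of [Z]. *)
Definition null_preserving (phi : 'cV[R]_n -> 'cV[R]_n) :=
  measurable_fun setT phi /\ forall N, measurable N ->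
    P (Z @^-1` N) = 0%E -> P ((phi \o Z) @^-1` N) = 0%E.

Lemma null_preserving_id : null_preserving idfun.
Proof. by split => [|N _ ->]; first exact: measurable_id. Qed.

Lemma null_preserving_comp phi psi :
  null_preserving phi -> null_preserving psi -> null_preserving (phi \o psi).
Proof.
move=> [mphi phi0] [mpsi psi0]; split; first exact: measurableT_comp.
move=> N mN N0; rewrite -compA comp_preimage; apply: (psi0 (phi @^-1` N)).
  by rewrite -[X in measurable X]setTI; exact: mphi.
exact: phi0.
Qed.

(** Since [f] ignores coordinate j, on each line parallel to axis j the map is an affine change of
    slope c. *)
Lemma null_preserving_coor (j : 'I_n) (c : R) (f : 'cV[R]_n -> R) : 0 < c ->
  measurable_fun setT f -> (forall z a, f (set_coor j z a) = f z) ->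
  null_preserving (fun z => set_coor j z (c * z j 0 + f z)).
Proof.
move=> c0 mf fj.
have mphi : measurable_fun setT
    (fun z : 'cV[R]_n => set_coor j z (c * z j 0 + f z)).
  apply: measurable_set_coor => //; apply: measurable_funD => //.
  by apply: measurable_funM => //; exact: measurable_coor.
split=> // N mN; rewrite (resampleE j mN) comp_preimage.
set phi := (fun z : 'cV[R]_n => _) in mphi *.
have mphiN : measurable (phi @^-1` N).
  by rewrite -[X in measurable X]setTI; exact: mphi.
rewrite (resampleE j mphiN).
have mS M : measurable M -> measurable (resample j @^-1` M).
  by move=> mM; rewrite -[X in measurable X]setTI; exact: mresample.
move=> /(product_null_ae P (nu j) (mS _ mN)) h.
apply/(product_null_ae P (nu j) (mS _ mphiN)).
(* On each fibre: a normal null set is Lebesgue null, so is its affine preimage, which is then null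
   for the normal law. *)
apply: filterS h => w /(lebesgue_dominates_normal sigma_gt0) => h.
have mA : measurable (xsection (resample j @^-1` N) w).
  by apply: measurable_xsection; exact: mS.
have /null_content_dominatesP := normal_prob_dominates (m j 0) sigma.
apply.
  by apply: measurable_xsection; exact: mS.
have := lebesgue_null_affine (f (Z w)) c0 mA (h mA).
congr (_ = _); congr lebesgue_measure.
apply/funext => a; rewrite /xsection/= !inE/= /resample/= /phi/=.
congr N; apply/matrixP => i k; rewrite !mxE fj/= eqxx.
by case: eqP.
Qed.

(** The coordinates in [J] can be updated one after the other: the shifts read only coordinates
    outside [J], which no update alters. *)
Lemma null_preserving_block (J : {set 'I_n}) (c : 'I_n -> R)
    (f : 'I_n -> 'cV[R]_n -> R) :
  (forall j, 0 < c j) -> (forall j, measurable_fun setT (f j)) ->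
  (forall j (z z' : 'cV[R]_n), j \in J ->
    (forall i, i \notin J -> z i 0 = z' i 0) -> f j z = f j z') ->
  null_preserving (fun z : 'cV[R]_n =>
    \col_i (if i \in J then c i * z i 0 + f i z else z i 0)).
Proof.
move=> c0 mf fJ.
suff : forall r : seq 'I_n, uniq r -> {subset r <= J} -> null_preserving
    (fun z : 'cV[R]_n =>
      \col_i (if i \in r then c i * z i 0 + f i z else z i 0)).
  move=> /(_ (enum J) (enum_uniq _)).
  have <- : (fun z : 'cV[R]_n =>
        \col_i (if i \in enum J then c i * z i 0 + f i z else z i 0)) =
      (fun z : 'cV[R]_n =>
        \col_i (if i \in J then c i * z i 0 + f i z else z i 0)).
    by apply/funext => z; apply/matrixP => i k; rewrite !mxE mem_enum.
  by apply => i; rewrite mem_enum.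
elim => [_ _|j r IH /= /andP[jr ur] rJ].
  rewrite (_ : (fun z : 'cV[R]_n => _) = idfun); first exact: null_preserving_id.
  by apply/funext => z; apply/matrixP => i k; rewrite mxE ord1.
have jJ : j \in J by apply: rJ; rewrite mem_head.
have {}IH := IH ur (fun i ir => rJ i (mem_behead (s := j :: r) ir)).
set phi := (fun z : 'cV[R]_n => _) in IH.
rewrite (_ : (fun z : 'cV[R]_n => _) =
    (fun z : 'cV[R]_n => set_coor j z (c j * z j 0 + f j z)) \o phi); last first.
  apply/funext => z; apply/matrixP => i k; rewrite !mxE inE.
  rewrite (negPf jr); case: eqP => [->|//]/=.
  congr (_ + _); apply: fJ => // l lJ; rewrite mxE.
  by case: ifP => // lr; rewrite rJ ?inE ?lr ?orbT in lJ.
apply: null_preserving_comp => //.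
apply: null_preserving_coor => // z a; apply: fJ => // i iJ; rewrite mxE.
by case: eqP => // ij; rewrite ij jJ in iJ.
Qed.

(** With t drawn from a standard normal law independently of [Z], almost every orbit hits [N] with
    probability 0. Fubini then yields one t for which [psi t] sends [Z] into [N] with probability
    0. *)
Lemma null_of_flow (psi : R -> 'cV[R]_n -> 'cV[R]_n) (N N0 : set 'cV[R]_n) :
  measurable N ->
  measurable_fun setT (fun x : 'cV[R]_n * R => psi x.2 x.1) ->
  (forall t, null_preserving (psi t)) ->
  (forall t z, psi t (psi (- t) z) = z) ->
  measurable N0 -> P (Z @^-1` N0) = 0%E ->
  (forall z, ~ N0 z -> finite_set [set t | N (psi t z)]) ->
  P (Z @^-1` N) = 0%E.
Proof.
move=> mN mpsi psi_null psiK mN0 PN0 finN.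
pose g : probability (measurableTypeR R) R := normal_prob 0 1.
pose h (x : Omega * measurableTypeR R) := psi x.2 (Z x.1).
have mh : measurable_fun setT h.
  have mpsi' : measurable_fun setT
      (fun x : 'cV[R]_n * measurableTypeR R => psi x.2 x.1) := mpsi.
  have mf : measurable_fun setT (fun x : Omega * measurableTypeR R => (Z x.1, x.2)).
    by apply: measurable_fun_pair => //; exact: measurableT_comp.
  exact: (measurableT_comp mpsi' mf).
have mS : measurable (h @^-1` N) by rewrite -[X in measurable X]setTI; exact: mh.
have [t /=] : exists t, P (ysection (h @^-1` N) t) = 0%E.
  apply: (product_null_exists (m2 := g)) => //.
  apply/product_null_ae => //.
  exists (Z @^-1` N0); split => //.
    by rewrite -[X in measurable X]setTI; exact: mZ.
  move=> w /=; apply: contra_notP => N0w.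
  have /null_content_dominatesP := normal_prob_dominates (0 : R) 1.
  apply; first exact: measurable_xsection.
  apply: countable_lebesgue_measure0; apply: finite_set_countable.
  apply: sub_finite_set (finN _ N0w) => t.
  by rewrite /xsection/= inE.
rewrite (_ : ysection _ _ = Z @^-1` (psi t @^-1` N)); last first.
  by apply/funext => w; rewrite /ysection/= inE.
have [_ /(_ (psi t @^-1` N))] := psi_null (- t).
have mtN : measurable (psi t @^-1` N).
  by rewrite -[X in measurable X]setTI; exact: (psi_null t).1.
move=> /(_ mtN) /[apply].
by congr (P _ = _); apply/funext => w; rewrite /preimage/= psiK.
Qed.

End resampling.

(** * Uniformity of the selective p-value *)

Section disintegration.
Local Open Scope ereal_scope.
Context (R : realType) (d dZ dY : measure_display) (Omega : measurableType d)
  (TZ : measurableType dZ) (TY : measurableType dY).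
Variables (P : probability Omega R) (Z : Omega -> TZ) (Y : Omega -> TY).
Variable kappa : R.-pker TZ ~> TY.
Hypotheses (mZ : measurable_fun setT Z) (mY : measurable_fun setT Y).

Lemma measurable_kernel_xsection (S : set (TZ * TY)) : measurable S ->
  measurable_fun setT (fun w => kappa (Z w) (xsection S (Z w))).
Proof.
move=> mS.
apply: (measurableT_comp (f := fun q => kappa q (xsection S q))) => //.
by apply: measurable_fun_xsection_finite_kernel; rewrite inE.
Qed.

(** For rectangles this is the defining identity of a regular conditional distribution; Dynkin's
    pi-lambda theorem extends it to the product sigma-algebra. *)
Lemma disintegration : regular_cond_distribution P Z Y kappa ->
  forall S : set (TZ * TY), measurable S ->
  \int[P]_w kappa (Z w) (xsection S (Z w)) = P [set w | S (Z w, Y w)].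
Proof.
move=> hk S mS.
have mZY S' : measurable S' -> measurable [set w | S' (Z w, Y w)].
  move=> mS'; rewrite -[X in measurable X]setTI.
  by apply: (measurable_fun_pair mZ mY).
move: S mS; rewrite measurable_prod_measurableType.
apply: dynkin_induction.
- exact: measurable_prod_measurableType.
- move=> _ _ [X1 mX1 [X2 mX2 <-]] [Y1 mY1 [Y2 mY2 <-]].
  exists (X1 `&` Y1); first exact: measurableI.
  by exists (X2 `&` Y2); [exact: measurableI|rewrite setXI].
- transitivity (\int[P]_w (cst 1 w)).
    by apply: eq_integral => w _; rewrite xsectionE preimage_setT prob_kernel.
  by rewrite integral_cst// mul1e.
- move=> _ [B mB [C mC <-]].
  have mZB : measurable (Z @^-1` B) by rewrite -[X in measurable X]setTI; exact: mZ.
  rewrite [RHS](_ : _ = P (Z @^-1` B `&` Y @^-1` C))//.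
  rewrite -(hk B C mB mC) [RHS]integral_mkcond.
  apply: eq_integral => w _; rewrite patchE; case: ifPn.
    by rewrite inE => Bw; rewrite in_xsectionX// inE.
  by rewrite notin_setE => Bw; rewrite notin_xsectionX ?measure0// notin_setE.
- move=> S mS hS.
  (* The sections of [S] and of its complement split the unit mass of each [kappa (Z w)], so the two
     integrals add up to 1. *)
  have : \int[P]_w kappa (Z w) (xsection (~` S) (Z w)) +
      \int[P]_w kappa (Z w) (xsection S (Z w)) = 1.
    rewrite -ge0_integralD//; first last.
    - exact: measurable_kernel_xsection.
    - by apply: measurable_kernel_xsection; exact: measurableC.
    rewrite -(probability_setT P) -[RHS]mul1e -integral_cst//.
    apply: eq_integral => w _.
    rewrite -measureU.
    - by rewrite !xsectionE -preimage_setU setvU preimage_setT; exact: prob_kernel.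
    - by apply: measurable_xsection; exact: measurableC.
    - exact: measurable_xsection.
    - by rewrite !xsectionE -preimage_setI setICl preimage_set0.
  rewrite hS => h.
  rewrite [RHS](_ : _ = P (~` [set w | S (Z w, Y w)]))//.
  rewrite probability_setC; last exact: mZY.
  by rewrite -h addeK// fin_num_measure//; exact: mZY.
- move=> F mF tF hF.
  rewrite [RHS](_ : _ = P (\bigcup_k [set w | F k (Z w, Y w)])); last first.
    by congr (P _); apply/seteqP; split => w [k _ Fk]; exists k.
  rewrite measure_semi_bigcup; last 3 first.
  - by move=> i; exact: mZY.
  - apply/trivIsetP => i j _ _ ij; apply/seteqP; split => w //= [Fi Fj].
    move/trivIsetP : tF => /(_ _ _ I I ij)/seteqP[+ _]; apply.
    by split; [exact: Fi|exact: Fj].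
  - by apply: bigcupT_measurable => i; exact: mZY.
  transitivity (\int[P]_w (\sum_(0 <= i <oo) kappa (Z w) (xsection (F i) (Z w)))).
    apply: eq_integral => w _; rewrite xsection_bigcup measure_semi_bigcup//.
    - by move=> i; exact: measurable_xsection.
    - exact: trivIset_xsection.
    - by apply: bigcupT_measurable => i; exact: measurable_xsection.
  rewrite integral_nneseries//; last first.
    by move=> i; exact: measurable_kernel_xsection.
  by apply: eq_eseriesr => i _; exact: hF.
Qed.

End disintegration.

Lemma measurable_set_bool d (T : measurableType d) (b : T -> bool) :
  measurable_fun setT b -> measurable [set x | b x].
Proof.
move=> mb; rewrite -[X in measurable X]setTI.
exact: (mb measurableT [set true]).
Qed.

Section atomless_pvalue.
Context (R : realType) (d dZ : measure_display) (Omega : measurableType d)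
  (TZ : measurableType dZ).
Variables (P : probability Omega R) (Z : Omega -> TZ) (Y : Omega -> R).
Variable kappa : R.-pker TZ ~> R.
Hypotheses (mZ : measurable_fun setT Z) (mY : measurable_fun setT Y).
Hypothesis hk : regular_cond_distribution P Z Y kappa.
Hypothesis atomless : forall g : TZ -> R, measurable_fun setT g ->
  P [set w | `|Y w| = g (Z w)] = 0%E.

Let kappaT q : kappa q setT = 1%E. Proof. exact: prob_kernel. Qed.

Let tail q (r : R) := kappa q [set u : R | r <= `|u|].

Let mtail (r : R) : measurable [set u : R | r <= `|u|].
Proof.
rewrite (_ : mkset _ = setT `&` (@Num.norm R R) @^-1` `[r, +oo[).
  exact: normr_measurable.
by apply/seteqP; split => u; rewrite /= in_itv/= andbT => // -[].
Qed.

Let tail_le1 q r : (tail q r <= 1)%E.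
Proof. by rewrite -(kappaT q); apply: le_measure; rewrite ?inE. Qed.

Let tail_nonincr q (r r' : R) : r <= r' -> (tail q r' <= tail q r)%E.
Proof.
by move=> rr'; apply: le_measure; rewrite ?inE// => u /=; exact: le_trans.
Qed.

Variable alpha : R.
Hypotheses (alpha_gt0 : 0 < alpha) (alpha_lt1 : alpha < 1).

(** The strict inequality makes the supremum [c q] an exact cutoff: the tail exceeds [alpha] below
    it and is at most [alpha] above it. If the tail equals [alpha] on an interval, [c q] is its left
    end. *)
Let A q := [set r : R | alpha%:E < tail q r]%E.
Let c q := sup (A q).

(** At 0 the tail is 1, above [alpha]. The tail tends to 0 along the integers by continuity from
    above, so positivity of [alpha] bounds [A q]. *)
Let supA q : has_sup (A q).
Proof.
split.
  exists 0; rewrite /A/= /tail (_ : mkset _ = setT); last first.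
    by apply/seteqP; split => u //= _.
  by rewrite kappaT lte_fin.
apply: contrapT => nub.
have tailn (n : nat) : (alpha%:E < tail q n%:R)%E.
  apply: contrapT => /negP; rewrite -leNgt => h; apply: nub.
  exists n%:R => r; rewrite /A/= => hr; rewrite leNgt; apply/negP => nr.
  have := lt_le_trans hr (tail_nonincr q (ltW nr)).
  by rewrite ltNge h.
have : (tail q \o (fun n : nat => n%:R)) n @[n --> \oo] -->
    kappa q (\bigcap_n [set u : R | n%:R <= `|u|]).
  apply: (@nonincreasing_cvg_mu _ _ _ (kappa q)
    (fun n => [set u : R | n%:R <= `|u|])) => //.
  - by rewrite (le_lt_trans (tail_le1 q _)) ?ltry.
  - exact: bigcapT_measurable.
  - move=> m n mn; apply/subsetPset => u /=; apply: le_trans.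
    by rewrite ler_nat.
rewrite (_ : \bigcap_n _ = set0) ?measure0; last first.
  apply/seteqP; split => // u /(_ (Num.truncn `|u|).+1 I)/=.
  by rewrite leNgt truncnS_gt.
move=> tail0.
have : (alpha%:E <= 0)%E.
  by apply: cvge_ge tail0; apply: nearW => n; exact/ltW/tailn.
by rewrite lee_fin leNgt alpha_gt0.
Qed.

Let tail_gt q (r : R) : r < c q -> (alpha%:E < tail q r)%E.
Proof.
move=> rc; have cr : 0 < c q - r by rewrite subr_gt0.
have [e Ae ce] := sup_adherent cr (supA q).
apply: (lt_le_trans Ae); apply: tail_nonincr; apply: ltW.
by move: ce; rewrite -/(c q) opprB addrC subrK.
Qed.

Let tail_le q (r : R) : c q < r -> (tail q r <= alpha%:E)%E.
Proof.
move=> cr; rewrite leNgt; apply/negP => h.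
by have := sup_upper_bound (supA q) h; rewrite leNgt cr.
Qed.

(** Continuity from above along the thresholds c - 1/(n+1), all of which have tail above [alpha]. *)
Let tail_c q : (alpha%:E <= tail q (c q))%E.
Proof.
have : (tail q \o (fun n : nat => c q - n.+1%:R^-1)) n @[n --> \oo] -->
    kappa q (\bigcap_n [set u : R | c q - n.+1%:R^-1 <= `|u|]).
  apply: (@nonincreasing_cvg_mu _ _ _ (kappa q)
    (fun n => [set u : R | c q - n.+1%:R^-1 <= `|u|])) => //.
  - by rewrite (le_lt_trans (tail_le1 q _)) ?ltry.
  - exact: bigcapT_measurable.
  - move=> m n mn; apply/subsetPset => u /=; apply: le_trans.
    by rewrite lerD2l lerN2 lef_pV2 ?posrE// ler_nat.
rewrite (_ : \bigcap_n _ = [set u | c q <= `|u|]); last first.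
  apply/seteqP; split => u /=; last first.
    by move=> cu n _ /=; apply: le_trans cu; rewrite gerBl.
  move=> h; apply/ler_addgt0Pr => e e0.
  have /= := h (Num.truncn e^-1) I; rewrite lerBlDr => /le_trans; apply.
  rewrite lerD2l invf_ple ?posrE//.
  exact: ltW (truncnS_gt _).
apply: cvge_ge; apply: nearW => n /=; apply/ltW/tail_gt.
by rewrite gtrBl.
Qed.

(** The open tail is the increasing union of the closed tails at c + 1/(n+1), each of mass at most
    [alpha]. *)
Let tail_c_strict q : (kappa q [set u | (c q < `|u|)%R] <= alpha%:E)%E.
Proof.
have mtl n : measurable [set u : R | c q + n.+1%:R^-1 <= `|u|] by [].
have : (tail q \o (fun n : nat => c q + n.+1%:R^-1)) n @[n --> \oo] -->
    kappa q (\bigcup_n [set u : R | c q + n.+1%:R^-1 <= `|u|]).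
  apply: (@nondecreasing_cvg_mu _ _ _ (kappa q)
    (fun n => [set u : R | c q + n.+1%:R^-1 <= `|u|])) => //.
  - exact: bigcupT_measurable.
  - move=> m n mn; apply/subsetPset => u /=; apply: le_trans.
    by rewrite lerD2l lef_pV2 ?posrE// ler_nat.
rewrite (_ : \bigcup_n _ = [set u | c q < `|u|]); last first.
  apply/seteqP; split => u /=.
    by move=> [n _ /=]; apply: lt_le_trans; rewrite ltrDl.
  rewrite -subr_gt0 => cu; exists (Num.truncn (`|u| - c q)^-1) => //=.
  rewrite addrC -lerBrDr invf_ple ?posrE//.
  exact: ltW (truncnS_gt _).
apply: cvge_le; apply: nearW => n /=; apply: tail_le.
by rewrite ltrDl.
Qed.

Let mc : measurable_fun setT c.
Proof.
apply: (measurability _ (RGenOInfty.measurableE R)) => // _ [_ [x ->] <-].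
(* The event x < c(q) holds iff some rational r > x has tail above [alpha]; each tail at a fixed r
   is measurable in q. *)
rewrite setTI (_ : _ @^-1` _ =
  \bigcup_(r : rat) [set q | x < ratr r /\ (alpha%:E < tail q (ratr r))%E]).
  apply: bigcupT_measurable_rat => r.
  have [xr|xr] := boolP (x < ratr r).
    rewrite (_ : mkset _ = [set q | (alpha%:E < tail q (ratr r))%E]).
      rewrite -[X in measurable X]setTI.
      by apply: emeasurable_fun_o_infty => //; exact: measurable_kernel.
    by apply/seteqP; split => q //= -[].
  rewrite (_ : mkset _ = set0)//.
  by apply/seteqP; split => q //= -[].
apply/seteqP; split => q /=.
  rewrite in_itv/= andbT => /rat_in_itvoo[r]; rewrite in_itv/= => /andP[xr rc].
  by exists r => //; split => //; exact: tail_gt.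
move=> [r _ [xr h]]; rewrite in_itv/= andbT; apply: (lt_le_trans xr).
exact: sup_upper_bound (supA q) _ h.
Qed.

Let pvalue w := selective_pvalue kappa (Z w) (Y w).

Let mcZ : measurable_fun setT (c \o Z). Proof. exact: measurableT_comp. Qed.

Let mnY : measurable_fun setT (fun w => `|Y w|).
Proof. exact: measurableT_comp. Qed.

Let D := [set w | `|Y w| = c (Z w)].
Let U := [set w | c (Z w) < `|Y w|].

Let mD : measurable D.
Proof.
rewrite (_ : D = [set w | `|Y w| == c (Z w)]).
  by apply: measurable_set_bool; exact: measurable_fun_eqr.
by apply/seteqP; split => w /eqP.
Qed.

Let mU : measurable U.
Proof.
by apply: measurable_set_bool; exact: measurable_fun_ltr.
Qed.

Let mtailc : measurable_fun setT (fun w => tail (Z w) (c (Z w))).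
Proof.
pose S := [set x : TZ * R | c x.1 <= `|x.2|].
have mS : measurable S.
  apply: measurable_set_bool; apply: measurable_fun_ler.
  - exact: measurableT_comp.
  - exact: measurableT_comp.
have := measurable_kernel_xsection kappa mZ mS.
congr measurable_fun; apply/funext => w.
by rewrite /tail xsectionE.
Qed.

Lemma pvalue_leE : [set w | (pvalue w <= alpha%:E)%E] =
  U `|` (D `&` [set w | (tail (Z w) (c (Z w)) <= alpha%:E)%E]).
Proof.
apply/seteqP; split => w /=; rewrite /pvalue /selective_pvalue -/(tail (Z w) `|Y w|).
  rewrite /U /D/=; case: (ltgtP (c (Z w)) `|Y w|) => [|/tail_gt|->] h.
  - by left.
  - by rewrite leNgt h.
  - by right.
by case=> [/tail_le//|[<-]].
Qed.

Lemma measurable_pvalue_le : measurable [set w | (pvalue w <= alpha%:E)%E].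
Proof.
rewrite pvalue_leE; apply: measurableU => //; apply: measurableI => //.
rewrite -[X in measurable X]setTI.
exact: emeasurable_fun_infty_c.
Qed.

(** The event differs from [U] by a part of the null set [D]. Integrating the kernel bounds gives P
    U <= alpha and P (U [|] D) >= alpha, and these two probabilities coincide. *)
Lemma pvalue_uniform_interior : P [set w | (pvalue w <= alpha%:E)%E] = alpha%:E.
Proof.
have PD : P D = 0%E by exact: atomless.
have mT : measurable [set w | (tail (Z w) (c (Z w)) <= alpha%:E)%E].
  rewrite -[X in measurable X]setTI; exact: emeasurable_fun_infty_c.
have PDT : P (D `&` [set w | (tail (Z w) (c (Z w)) <= alpha%:E)%E]) = 0%E.
  by apply: (subset_measure0 _ mD _ PD) => //; exact: measurableI.
rewrite pvalue_leE [LHS](measureU0 _ _ PDT)//; last exact: measurableI.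
have mcx : measurable_fun setT (fun x : TZ * R => c x.1).
  exact: measurableT_comp.
have mnx : measurable_fun setT (fun x : TZ * R => `|x.2|).
  exact: measurableT_comp.
apply/eqP; rewrite eq_le; apply/andP; split.
  have mS : measurable [set x : TZ * R | c x.1 < `|x.2|].
    by apply: measurable_set_bool; exact: measurable_fun_ltr.
  rewrite [leLHS](_ : _ = P [set w | [set x : TZ * R | c x.1 < `|x.2|] (Z w, Y w)])//.
  rewrite -(disintegration mZ mY hk mS).
  rewrite -[leRHS]mule1 -(probability_setT P) -integral_cst//.
  apply: ge0_le_integral => //.
  - exact: measurable_kernel_xsection.
  - by move=> w _; rewrite xsectionE; exact: tail_c_strict.
rewrite -(measureU0 mU mD PD).
rewrite (_ : U `|` D = [set w | c (Z w) <= `|Y w|]); last first.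
  apply/seteqP; split => w; rewrite /U /D/= le_eqVlt.
    by case=> [->|->]; rewrite ?eqxx ?orbT.
  by case/orP => [/eqP|]; [right|left].
have mS : measurable [set x : TZ * R | c x.1 <= `|x.2|].
  by apply: measurable_set_bool; exact: measurable_fun_ler.
rewrite [leRHS](_ : _ = P [set w | [set x : TZ * R | c x.1 <= `|x.2|] (Z w, Y w)])//.
rewrite -(disintegration mZ mY hk mS).
rewrite -[leLHS]mule1 -(probability_setT P) -integral_cst//.
apply: ge0_le_integral => //.
- by move=> w _; rewrite /= lee_fin ltW.
- exact: measurable_kernel_xsection.
- by move=> w _; rewrite xsectionE; exact: tail_c.
Qed.

End atomless_pvalue.

Lemma pvalue_uniform (R : realType) (d dZ : measure_display)
    (Omega : measurableType d) (TZ : measurableType dZ)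
    (P : probability Omega R) (Z : Omega -> TZ) (Y : Omega -> R)
    (kappa : R.-pker TZ ~> R) :
  measurable_fun setT Z -> measurable_fun setT Y ->
  regular_cond_distribution P Z Y kappa ->
  (forall g : TZ -> R, measurable_fun setT g ->
    P [set w | `|Y w| = g (Z w)] = 0%E) ->
  forall alpha : R, 0 <= alpha <= 1 ->
  P [set w | (selective_pvalue kappa (Z w) (Y w) <= alpha%:E)%E] = alpha%:E.
Proof.
move=> mZ mY hk atomless alpha /andP[].
rewrite [alpha <= 1]le_eqVlt => + /orP[/eqP ->|alpha1].
  move=> _; rewrite -(probability_setT P); congr (P _).
  apply/seteqP; split => w //= _.
  rewrite probability_setT -(@prob_kernel _ _ _ _ _ kappa (Z w)).
  apply: le_measure; rewrite ?inE//.
  by apply: measurable_set_bool; exact: measurable_fun_ler.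
rewrite le_eqVlt => /orP[/eqP <-|alpha0]; last exact: pvalue_uniform_interior.
pose F e := [set w | (selective_pvalue kappa (Z w) (Y w) <= e%:E)%E].
have mF e : 0 < e -> e < 1 -> measurable (F e).
  exact: measurable_pvalue_le.
(* Level 0 is reached through levels 1/(n+2), which lie strictly between 0 and 1; the intersection
   also shows that [F 0] is measurable. *)
have F0 : F 0 = \bigcap_n F n.+2%:R^-1.
  apply/seteqP; split => w.
    by move=> w0 n _; apply: le_trans w0 _; rewrite lee_fin.
  move=> h; apply/lee_addgt0Pr => e e0; rewrite add0e.
  apply: le_trans (h (Num.truncn e^-1) I) _.
  rewrite lee_fin invf_ple ?posrE//.
  by rewrite (le_trans (ltW (truncnS_gt _)))// ler_nat.
have n2 n : (n.+2%:R^-1 : R) < 1 by rewrite invf_lt1// ltr1n.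
apply/eqP; rewrite eq_le measure_ge0 andbT; apply/lee_addgt0Pr => e e0.
rewrite add0e.
pose n := Num.truncn e^-1.
apply: (@le_trans _ _ (P (F n.+2%:R^-1))).
  apply: le_measure; rewrite ?inE; last 1 first.
  - by move=> w w0; apply: le_trans w0 _; rewrite lee_fin.
  - by rewrite -/(F 0) F0; apply: bigcapT_measurable => k; exact: mF.
  - exact: mF.
rewrite (pvalue_uniform_interior mZ mY hk atomless)// lee_fin invf_ple ?posrE//.
by rewrite (le_trans (ltW (truncnS_gt _)))// ler_nat.
Qed.

(** * Gaussian vectors and translations *)

Section measurable_cV_real.
Context (R : realType) (d : measure_display) (S : measurableType d).

Lemma measurable_cV_coor n (f : S -> 'cV[R]_n) i :
  measurable_fun setT f -> measurable_fun setT (fun x => f x i 0).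
Proof. exact: (measurableT_comp (@measurable_coor _ _ n i)). Qed.

Lemma measurable_addmx n (f g : S -> 'cV[R]_n) :
  measurable_fun setT f -> measurable_fun setT g ->
  measurable_fun setT (fun x => f x + g x).
Proof.
move=> mf mg; apply: measurable_fun_cV => i.
under eq_fun do rewrite mxE.
by apply: measurable_funD; exact: measurable_cV_coor.
Qed.

Lemma measurable_scalemx n (a : S -> R) (f : S -> 'cV[R]_n) :
  measurable_fun setT a -> measurable_fun setT f ->
  measurable_fun setT (fun x => a x *: f x).
Proof.
move=> ma mf; apply: measurable_fun_cV => i.
under eq_fun do rewrite mxE.
by apply: measurable_funM => //; exact: measurable_cV_coor.
Qed.

Lemma measurable_mulmx m n (B : 'M[R]_(m, n)) (f : S -> 'cV[R]_n) :
  measurable_fun setT f -> measurable_fun setT (fun x => B *m f x).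
Proof.
move=> mf; apply: measurable_fun_cV => i.
under eq_fun do rewrite mxE.
apply: measurable_sum => j.
by apply: measurable_funM => //; exact: measurable_cV_coor.
Qed.

Lemma measurable_col_mx m n (f : S -> 'cV[R]_m) (g : S -> 'cV[R]_n) :
  measurable_fun setT f -> measurable_fun setT g ->
  measurable_fun setT (fun x => col_mx (f x) (g x)).
Proof.
move=> mf mg; apply: measurable_fun_cV => i.
case: (split_ordP i) => j ->.
- by under eq_fun do rewrite col_mxEu; exact: measurable_cV_coor.
- by under eq_fun do rewrite col_mxEd; exact: measurable_cV_coor.
Qed.

Lemma measurable_euclidean_norm n (f : S -> 'cV[R]_n) :
  measurable_fun setT f -> measurable_fun setT (fun x => euclidean_norm (f x)).
Proof.
move=> mf; have msqrt : measurable_fun setT (@Num.sqrt R).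
  by apply: continuous_measurable_fun; exact: sqrt_continuous.
apply: (measurableT_comp msqrt).
apply: measurable_sum => i; apply: measurable_funX.
exact: measurable_cV_coor.
Qed.

(** Meant for [r] the salient region: it takes finitely many values, so measurability can be checked
    with the region held fixed. *)
Lemma measurable_fun_finite_cases (F : finType) d' (T : measurableType d')
    (r : S -> F) (h : F -> S -> T) :
  (forall x, measurable [set w | r w = x]) ->
  (forall x, measurable_fun setT (h x)) ->
  measurable_fun setT (fun w => h (r w) w).
Proof.
move=> mr mh _ B mB; rewrite setTI.
rewrite (_ : _ @^-1` B =
    \bigcup_(x in [set: F]) ([set w | r w = x] `&` h x @^-1` B)).
  apply: fin_bigcup_measurable; first exact: finite_finset.
  move=> x _; apply: measurableI => //.
  by rewrite -[X in measurable X]setTI; exact: mh.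
apply/seteqP; split => w /=; first by move=> Bw; exists (r w).
by move=> [x _ /= [<-]].
Qed.

End measurable_cV_real.

Section euclidean_norm_theory.
Context (R : realType) (n : nat).
Implicit Types x : 'cV[R]_n.

Lemma euclidean_norm_ge0 x : 0 <= euclidean_norm x.
Proof. exact: sqrtr_ge0. Qed.

Lemma euclidean_norm_sqr x : euclidean_norm x ^+ 2 = \sum_i x i 0 ^+ 2.
Proof. by rewrite sqr_sqrtr// sumr_ge0// => i _; rewrite sqr_ge0. Qed.

Lemma euclidean_norm_sqrE x : euclidean_norm x ^+ 2 = (x^T *m x) 0 0.
Proof.
by rewrite euclidean_norm_sqr mxE; apply: eq_bigr => i _; rewrite mxE expr2.
Qed.

Lemma euclidean_normZ (a : R) x : 0 <= a ->
  euclidean_norm (a *: x) = a * euclidean_norm x.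
Proof.
move=> a0; rewrite /euclidean_norm.
under eq_bigr do rewrite mxE exprMn.
by rewrite -mulr_sumr sqrtrM ?sqr_ge0// sqrtr_sqr ger0_norm.
Qed.

Lemma euclidean_norm_gt0 x i : x i 0 != 0 -> 0 < euclidean_norm x.
Proof.
move=> xi; rewrite sqrtr_gt0 (bigD1 i)//= ltr_pwDl//.
  by rewrite exprn_even_gt0.
by rewrite sumr_ge0// => j _; rewrite sqr_ge0.
Qed.

End euclidean_norm_theory.

Lemma isotropic_normal_col_mx (R : realType) (d : measure_display)
    (Omega : measurableType d) (P : probability Omega R) m n
    (X : Omega -> 'cV[R]_m) (Y : Omega -> 'cV[R]_n) s t sigma :
  independent_pair P X Y -> isotropic_normal P X s sigma ->
  isotropic_normal P Y t sigma ->
  isotropic_normal P (fun w => col_mx (X w) (Y w)) (col_mx s t) sigma.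
Proof.
move=> hXY hX hY B mB; rewrite big_split_ord/=.
rewrite (_ : mkset _ =
    X @^-1` [set x : 'cV[R]_m | forall i, B (lshift n i) (x i 0)] `&`
    Y @^-1` [set y : 'cV[R]_n | forall i, B (rshift m i) (y i 0)]); last first.
  apply/seteqP; split => w /=.
    by move=> h; split => i; [have := h (lshift n i)|have := h (rshift m i)];
      rewrite ?col_mxEu ?col_mxEd.
  by move=> [h1 h2] i; case: (split_ordP i) => j ->; rewrite ?col_mxEu ?col_mxEd.
have mBl i := mB (lshift n i).
have mBr i := mB (rshift m i).
rewrite [LHS](hXY _ _ (measurable_cV_box mBl) (measurable_cV_box mBr)).
rewrite [P (X @^-1` _)](hX _ mBl) [P (Y @^-1` _)](hY _ mBr).
by congr (_ * _)%E; apply: eq_bigr => i _; rewrite ?col_mxEu ?col_mxEd.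
Qed.

Section translation.
Context (R : realType) (d : measure_display) (Omega : measurableType d).
Variables (P : probability Omega R) (n : nat) (Z : Omega -> 'cV[R]_n).
Variables (m : 'cV[R]_n) (sigma : R).
Hypothesis (mZ : measurable_fun setT Z) (sigma_gt0 : 0 < sigma).
Hypothesis (hZ : isotropic_normal P Z m sigma).

Lemma null_preserving_translation (v : 'cV[R]_n) :
  null_preserving P Z (fun z => z + v).
Proof.
rewrite (_ : (fun z => _) = (fun z : 'cV[R]_n =>
    \col_i (if i \in [set: 'I_n]%SET then 1 * z i 0 + v i 0 else z i 0))).
  by apply: (null_preserving_block mZ sigma_gt0 hZ (c := fun=> 1)
    (f := fun i _ => v i 0)).
by apply/funext => z; apply/colP => i; rewrite !mxE inE mul1r.
Qed.

Lemma null_of_lines (v : 'cV[R]_n) (N : set 'cV[R]_n) : measurable N ->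
  (forall z, finite_set [set t | N (z + t *: v)]) -> P (Z @^-1` N) = 0%E.
Proof.
move=> mN finN.
apply: (null_of_flow mZ (psi := fun t z => z + t *: v) (N0 := set0)) => //.
- apply: measurable_addmx => //; apply: measurable_scalemx => //.
- by move=> t; exact: null_preserving_translation.
- by move=> t z; rewrite scaleNr addrNK.
- by rewrite preimage_set0 measure0.
Qed.

(** Each line parallel to axis i meets this hyperplane once. It is the exceptional set of the global
    test. *)
Lemma null_eq_coor (i j : 'I_n) : i != j ->
  P (Z @^-1` [set z | z i 0 = z j 0]) = 0%E.
Proof.
move=> ij; apply: (null_of_lines (v := delta_mx i 0)).
  rewrite (_ : mkset _ = [set z | z i 0 == z j 0]).
    by apply: measurable_set_bool; apply: measurable_fun_eqr; exact: measurable_coor.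
  by apply/seteqP; split => z /eqP.
move=> z; apply: (sub_finite_set _ (finite_set1 (z j 0 - z i 0))) => t /=.
rewrite !mxE !eqxx [j == i]eq_sym (negPf ij) mulr0 addr0 mulr1 => <-.
by rewrite addrAC subrr add0r.
Qed.

End translation.

(** * The graphs of the two tests *)

Section graph_null.
Context (R : realType) (d : measure_display) (Omega : measurableType d).
Variables (P : probability Omega R) (n : nat) (Z : Omega -> 'cV[R]_(n + n)).
Variables (m : 'cV[R]_(n + n)) (sigma : R) (M : {set 'I_n}).
Hypothesis (mZ : measurable_fun setT Z) (sigma_gt0 : 0 < sigma).
Hypothesis (hZ : isotropic_normal P Z m sigma) (M_gt0 : (0 < #|M|)%N).

Let exM : exists i, i \in M.
Proof. by apply/set0Pn; rewrite -card_gt0. Qed.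

Section mean.
Let eta : 'cV[R]_(n + n) := eta_mean R M.
Let T (z : 'cV[R]_(n + n)) : R := (eta^T *m z) 0 0.
Let Q (z : 'cV[R]_(n + n)) :=
  (1%:M - (euclidean_norm eta ^+ 2)^-1 *: (eta *m eta^T)) *m z.

Lemma euclidean_norm_eta_mean_gt0 : 0 < euclidean_norm eta.
Proof.
have [i iM] := exM; apply: (@euclidean_norm_gt0 _ _ _ (lshift n i)).
by rewrite /eta /eta_mean mxE col_mxEu mxE iM mulr1 invr_eq0 pnatr_eq0 -lt0n.
Qed.

Lemma mean_graph_null (g : 'cV[R]_(n + n) -> R) : measurable_fun setT g ->
  P (Z @^-1` [set z | `|T z| = g (Q z)]) = 0%E.
Proof.
move=> mg; set k := euclidean_norm eta ^+ 2.
have k0 : k != 0 by rewrite gt_eqF// exprn_gt0// euclidean_norm_eta_mean_gt0.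
have Tt z t : T (z + t *: eta) = T z + t * k.
  by rewrite /T mulmxDr -scalemxAr [LHS]mxE [X in _ + X]mxE -euclidean_norm_sqrE.
(* The matrix in [Q] projects orthogonally to [eta], so translations along [eta] leave [Q] fixed
   while T moves at speed [k]. *)
have Qeta : Q eta = 0.
  rewrite /Q mulmxBl mul1mx -scalemxAl -mulmxA [eta^T *m eta]mx11_scalar.
  by rewrite -euclidean_norm_sqrE mul_mx_scalar scalerA mulVf// scale1r subrr.
have Qt z t : Q (z + t *: eta) = Q z.
  by rewrite /Q mulmxDr -scalemxAr -/(Q eta) Qeta scaler0 addr0.
apply: (null_of_lines mZ sigma_gt0 hZ (v := eta)).
  rewrite (_ : mkset _ = [set z | `|T z| == g (Q z)]).
    apply: measurable_set_bool; apply: measurable_fun_eqr.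
      by apply: measurableT_comp => //; apply: measurable_cV_coor; exact: measurable_mulmx.
    by apply: measurableT_comp => //; exact: measurable_mulmx.
  by apply/seteqP; split => z /eqP.
move=> z.
(* The two candidates solve T + t k = g(Q) and T + t k = -g(Q). *)
apply: (sub_finite_set _
  (finite_set2 ((g (Q z) - T z) / k) ((- g (Q z) - T z) / k))).
move=> t /=; rewrite Tt Qt => h.
have [h0|h0] := leP 0 (T z + t * k).
  by left; rewrite -h ger0_norm// addrAC subrr add0r mulfK.
by right; rewrite -h ltr0_norm// opprK addrAC subrr add0r mulfK.
Qed.

End mean.

Section global.
Let Pi := projection_global R M.
Implicit Types z : 'cV[R]_(n + n).

Lemma projection_global_lshift z i : (Pi *m z) (lshift n i) 0 =
  if i \in M then (z (lshift n i) 0 - z (rshift n i) 0) / 2 else 0.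
Proof.
rewrite -{1}[z]vsubmxK /Pi /projection_global -scalemxAl mul_block_col mxE.
rewrite col_mxEu mulNmx !mul_diag_mx !mxE.
by case: ifP => _ /=; field.
Qed.

Lemma projection_global_rshift z i : (Pi *m z) (rshift n i) 0 =
  if i \in M then (z (rshift n i) 0 - z (lshift n i) 0) / 2 else 0.
Proof.
rewrite -{1}[z]vsubmxK /Pi /projection_global -scalemxAl mul_block_col mxE.
rewrite col_mxEd mulNmx !mul_diag_mx !mxE.
by case: ifP => _ /=; field.
Qed.

Lemma projection_global_idem z : Pi *m (Pi *m z) = Pi *m z.
Proof.
apply/colP => k; case: (split_ordP k) => i ->.
  rewrite !projection_global_lshift projection_global_rshift; case: (i \in M) => //.
  by field.
rewrite !projection_global_rshift projection_global_lshift; case: (i \in M) => //.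
by field.
Qed.

(** Multiplication by e^t on the range of [Pi], identity on its kernel; the exponential makes the
    inverse of [psi t] equal to [psi (- t)]. *)
Let psi (t : R) z := z + (expR t - 1) *: (Pi *m z).

Lemma projection_global_dilation t z : Pi *m psi t z = expR t *: (Pi *m z).
Proof.
rewrite /psi mulmxDr -scalemxAr projection_global_idem.
by rewrite -{1}[Pi *m z]scale1r -scalerDl addrC subrK.
Qed.

Lemma orthogonal_global_dilation t z :
  (1%:M - Pi) *m psi t z = (1%:M - Pi) *m z.
Proof.
rewrite /psi mulmxDr -scalemxAr !mulmxBl !mul1mx projection_global_idem subrr.
by rewrite scaler0 addr0.
Qed.

Lemma dilationK t z : psi t (psi (- t) z) = z.
Proof.
rewrite {1}/psi projection_global_dilation scalerA mulrBl -expRD subrr expR0.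
by rewrite mul1r /psi -addrA -scalerDl addrA subrK subrr scale0r addr0.
Qed.

(* On the pair of coordinates i of x and x', with i in M, psi t is the matrix
   [[a, b], [b, a]] with a = (1 + e^t) / 2 and b = (1 - e^t) / 2; as
   a^2 - b^2 = e^t it factors as [[1, 0], [b/a, e^t/a]] * [[a, b], [0, 1]]. *)
Lemma null_preserving_dilation t : null_preserving P Z (psi t).
Proof.
pose a := (1 + expR t) / 2; pose b := (1 - expR t) / 2.
have a0 : 0 < a by rewrite divr_gt0// addr_gt0// expR_gt0.
(* [swap] gives each coordinate access to its partner in the other half. The partner of an index in
   [JL] or [JR] lies outside that set, as [null_preserving_block] demands. *)
pose swap z := col_mx (dsubmx z) (usubmx z).
have swapl z i : swap z (lshift n i) 0 = z (rshift n i) 0.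
  by rewrite /swap col_mxEu mxE.
have swapr z i : swap z (rshift n i) 0 = z (lshift n i) 0.
  by rewrite /swap col_mxEd mxE.
have mswap i : measurable_fun setT (fun z => swap z i 0).
  case: (split_ordP i) => j ->.
    by under eq_fun do rewrite swapl; exact: measurable_coor.
  by under eq_fun do rewrite swapr; exact: measurable_coor.
clearbody swap.
pose JL : {set 'I_(n + n)} := [set lshift n i | i in M]%SET.
pose JR : {set 'I_(n + n)} := [set rshift n i | i in M]%SET.
have JLl i : (lshift n i \in JL) = (i \in M) by rewrite mem_imset//; exact: lshift_inj.
have JRr i : (rshift n i \in JR) = (i \in M) by rewrite mem_imset//; exact: rshift_inj.
have JLr i : (rshift n i \in JL) = false.
  by apply/negbTE/imsetP => -[j _ /eqP]; rewrite eq_rlshift.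
have JRl i : (lshift n i \in JR) = false.
  by apply/negbTE/imsetP => -[j _ /eqP]; rewrite eq_lrshift.
have nL : null_preserving P Z (fun z => \col_i
    (if i \in JL then a * z i 0 + b * swap z i 0 else z i 0)).
  apply: (null_preserving_block mZ sigma_gt0 hZ (J := JL) (c := fun=> a)
    (f := fun i z => b * swap z i 0)) => //.
    by move=> j; apply: measurable_funM => //; exact: mswap.
  move=> j z z' /imsetP[i iM ->] zz'; rewrite !swapl zz'//.
  by rewrite JLr.
have nR : null_preserving P Z (fun z => \col_i
    (if i \in JR then expR t / a * z i 0 + b / a * swap z i 0 else z i 0)).
  apply: (null_preserving_block mZ sigma_gt0 hZ (J := JR) (c := fun=> expR t / a)
    (f := fun i z => b / a * swap z i 0)) => //.
  - by move=> _; rewrite divr_gt0// expR_gt0.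
  - by move=> j; apply: measurable_funM => //; exact: mswap.
  - move=> j z z' /imsetP[i iM ->] zz'; rewrite !swapr zz'//.
    by rewrite JRl.
have := null_preserving_comp nR nL; congr null_preserving.
have an0 : a != 0 by rewrite gt_eqF.
apply/funext => z; apply/colP => k; case: (split_ordP k) => i ->.
  rewrite /psi [RHS]mxE [X in _ = _ + X]mxE projection_global_lshift.
  rewrite /= !mxE JRl JLl swapl.
  by case: ifP => _; rewrite ?mulr0 ?addr0// /a /b; field.
rewrite /psi [RHS]mxE [X in _ = _ + X]mxE projection_global_rshift.
rewrite /= !mxE JRr JLr swapr mxE JLl swapl.
case: (i \in M); rewrite ?mulr0 ?addr0//.
have e0 : 1 + expR t != 0 by rewrite gt_eqF// addr_gt0// expR_gt0.
rewrite /a /b. by field.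
Qed.

Let T z : R := sigma^-1 * euclidean_norm (Pi *m z).
Let Q z : 'cV[R]_(n + n) * 'cV[R]_(n + n) :=
  ((sigma / euclidean_norm (Pi *m z)) *: (Pi *m z), (1%:M - Pi) *m z).

Lemma measurable_global_nuisance_region : measurable_fun setT Q.
Proof.
have mPi : measurable_fun setT (fun z => Pi *m z) by exact: measurable_mulmx.
apply: measurable_fun_pair; last exact: measurable_mulmx.
apply: measurable_scalemx => //; apply: measurable_funM => //.
(* The reciprocal of the norm is written as the power -1, a measurable function that agrees with the
   inverse on nonnegative reals, including at 0. *)
rewrite (_ : (fun z => _) =
    (@powR R ^~ (-1)) \o (fun z => euclidean_norm (Pi *m z))).
  by apply: measurableT_comp => //; exact: measurable_euclidean_norm.
by apply/funext => z /=; rewrite powR_inv1// euclidean_norm_ge0.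
Qed.

Lemma measurable_global_statistic_region : measurable_fun setT T.
Proof.
apply: measurable_funM => //; apply: measurable_euclidean_norm.
exact: measurable_mulmx.
Qed.

(** A dilation multiplies T by e^t and fixes both the normalized direction and the orthogonal part.
    When T > 0, the equation e^t T = g(Q) has at most one solution t. *)
Lemma global_graph_null (g : 'cV[R]_(n + n) * 'cV[R]_(n + n) -> R) :
  measurable_fun setT g -> P (Z @^-1` [set z | `|T z| = g (Q z)]) = 0%E.
Proof.
move=> mg; have [i iM] := exM.
pose N0 : set 'cV[R]_(n + n) := [set z | z (lshift n i) 0 = z (rshift n i) 0].
have lr : lshift n i != rshift n i by rewrite eq_lrshift.
apply: (null_of_flow mZ (psi := psi) (N0 := N0)).
- rewrite (_ : mkset _ = [set z | `|T z| == g (Q z)]).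
    apply: measurable_set_bool; apply: measurable_fun_eqr.
      by apply: measurableT_comp => //; exact: measurable_global_statistic_region.
    by apply: measurableT_comp => //; exact: measurable_global_nuisance_region.
  by apply/seteqP; split => z /eqP.
- apply: measurable_addmx => //; apply: measurable_scalemx.
    by apply: measurable_funB => //; exact: measurableT_comp.
  exact: measurable_mulmx.
- exact: null_preserving_dilation.
- exact: dilationK.
- rewrite (_ : N0 = [set z | z (lshift n i) 0 == z (rshift n i) 0]).
    by apply: measurable_set_bool; apply: measurable_fun_eqr; exact: measurable_coor.
  by apply/seteqP; split => z /eqP.
- exact: (null_eq_coor mZ sigma_gt0 hZ).
move=> z zN0.
(* Off [N0], the entry (x_i - x'_i) / 2 of the projected vector is nonzero. *)
have norm_gt0 : 0 < euclidean_norm (Pi *m z).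
  apply: (@euclidean_norm_gt0 _ _ _ (lshift n i)).
  rewrite projection_global_lshift iM mulf_eq0 invr_eq0 pnatr_eq0 orbF subr_eq0.
  exact/eqP.
have T_gt0 : 0 < T z by rewrite mulr_gt0// invr_gt0.
have Tt t : T (psi t z) = expR t * T z.
  by rewrite /T projection_global_dilation euclidean_normZ ?expR_ge0// mulrCA.
have Qt t : Q (psi t z) = Q z.
  rewrite /Q orthogonal_global_dilation projection_global_dilation.
  rewrite euclidean_normZ ?expR_ge0// scalerA; congr (_ *: _, _).
  have et : expR t != 0 by rewrite gt_eqF// expR_gt0.
  by field; rewrite et gt_eqF.
apply: (sub_finite_set _ (finite_set1 (ln (g (Q z) / T z)))) => t /=.
rewrite Tt Qt ger0_norm; last by rewrite pmulr_lge0// expR_ge0.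
by move=> <-; rewrite mulfK ?gt_eqF// expRK.
Qed.

End global.

End graph_null.

(** * Conditioning on the salient region *)

Lemma cond_probability_null (R : realType) (d : measure_display)
    (Omega : measurableType d) (P : probability Omega R) (E A : set Omega)
    (mE : measurable E) :
  (0 < P E)%E -> P (A `&` E) = 0%E -> cond_probability P mE A = 0%E.
Proof.
move=> PE AE0.
have evE : mrestr P mE setT = P E by rewrite /mrestr setTI.
have PEy : (P E < +oo)%E by rewrite (le_lt_trans (probability_le1 P mE)) ?ltry.
rewrite /cond_probability /= /mnormalize.
(* The fallback cases of [mnormalize], total mass 0 or infinite, contradict 0 < P E <= 1. *)
case: ifPn => [/orP[] /eqP ev|_]; last by rewrite [X in (X * _)%E]AE0 mul0e.
- by move: PE; rewrite -(etrans (esym ev) evE) ltxx.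
- by move: PEy; rewrite -(etrans (esym ev) evE) ltxx.
Qed.

(** Common to both tests: the statistics are families indexed by a fixed region. On the conditioning
    event the random region equals [M], so its graph event is contained in the null one for [M]. *)
Lemma cond_pvalue_uniform (R : realType) (n : nat) (tau : R)
    (A : {mfun 'cV[R]_n >-> 'cV[R]_n}) (d : measure_display)
    (Omega : measurableType d) (P : probability Omega R)
    (X : {RV P >-> 'cV[R]_n}) (M : {set 'I_n})
    (dQ : measure_display) (TQ : measurableType dQ)
    (T : {set 'I_n} -> Omega -> R) (Q : {set 'I_n} -> Omega -> TQ) :
  (0 < P (salient_event A tau X M))%E ->
  (forall M', measurable_fun setT (T M')) ->
  (forall M', measurable_fun setT (Q M')) ->
  (forall g : TQ -> R, measurable_fun setT g ->
    P [set w | `|T M w| = g (Q M w)] = 0%E) ->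
  let PM := cond_probability P (measurable_salient_event A tau X M) in
  let S w := salient_region A tau (X w) in
  forall kappa : R.-pker TQ ~> R,
  regular_cond_distribution PM (fun w => Q (S w) w) (fun w => T (S w) w)
    kappa ->
  forall alpha : R, 0 <= alpha <= 1 ->
    PM [set w | (selective_pvalue kappa (Q (S w) w) (T (S w) w) <=
      alpha%:E)%E] = alpha%:E.
Proof.
move=> hM mT mQ graph0 PM S kappa hk.
have mS M' : measurable [set w | S w = M'] by exact: measurable_salient_event.
have mTS : measurable_fun setT (fun w => T (S w) w).
  exact: measurable_fun_finite_cases.
have mQS : measurable_fun setT (fun w => Q (S w) w).
  exact: measurable_fun_finite_cases.
apply: pvalue_uniform => // g mg.
apply: cond_probability_null => //.
have mgraph (T' : Omega -> R) (Q' : Omega -> TQ) :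
    measurable_fun setT T' -> measurable_fun setT Q' ->
    measurable [set w | `|T' w| = g (Q' w)].
  move=> mT' mQ'; rewrite (_ : mkset _ = [set w | `|T' w| == g (Q' w)]).
    by apply: measurable_set_bool; apply: measurable_fun_eqr; exact: measurableT_comp.
  by apply/seteqP; split => w /eqP.
apply: (subset_measure0 _ _ _ (graph0 g mg)).
- by apply: measurableI; [exact: mgraph|exact: mS].
- exact: mgraph.
- by move=> w [/=]; rewrite /S => + SM; rewrite SM.
Qed.

Theorem mainTheorem1 (R : realType) (n : nat) (sigma tau : R)
    (A : {mfun 'cV[R]_n >-> 'cV[R]_n}) (s sref : 'cV[R]_n)
    (d : measure_display) (Omega : measurableType d) (P : probability Omega R)
    (X Xref : {RV P >-> 'cV[R]_n}) (M : {set 'I_n})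
    (hn : (1 <= n)%N) (hsigma : 0 < sigma)
    (hX : isotropic_normal P X s sigma)
    (hXref : isotropic_normal P Xref sref sigma)
    (hindep : independent_pair P X Xref)
    (hM0 : (0 < #|M|)%N)
    (hM : (0 < P (salient_event A tau X M))%E) :
  let PM := cond_probability P (measurable_salient_event A tau X M) in
  (mean_null M s sref ->
   let T := fun w => mean_statistic A tau (X w) (Xref w) in
   let Q := fun w => mean_nuisance A tau (X w) (Xref w) in
   forall kappa : R.-pker 'cV[R]_(n + n) ~> R,
     regular_cond_distribution PM Q T kappa ->
     forall alpha : R, 0 <= alpha <= 1 ->
       PM [set w | (selective_pvalue kappa (Q w) (T w) <= alpha%:E)%E] =
         alpha%:E) /\
  (global_null M s sref ->
   let T := fun w => global_statistic A tau sigma (X w) (Xref w) in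
   let Q := fun w => global_nuisance A tau sigma (X w) (Xref w) in
   forall kappa : R.-pker ('cV[R]_(n + n) * 'cV[R]_(n + n)) ~> R,
     regular_cond_distribution PM Q T kappa ->
     forall alpha : R, 0 <= alpha <= 1 ->
       PM [set w | (selective_pvalue kappa (Q w) (T w) <= alpha%:E)%E] =
         alpha%:E).
Proof.
pose Z w := col_mx (X w) (Xref w).
have mZ : measurable_fun setT Z by exact: measurable_col_mx.
have hZ := isotropic_normal_col_mx hindep hX hXref.
move=> PM; split => _ T Q kappa.
(* The statistics of the test are rewritten as functions of the stacked vector [Z] with the region
   [M'] as a free parameter. *)
- apply: (cond_pvalue_uniform (M := M)
    (T := fun M' w => ((eta_mean R M')^T *m Z w) 0 0)
    (Q := fun M' w => (1%:M - (euclidean_norm (eta_mean R M') ^+ 2)^-1 *: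
       (eta_mean R M' *m (eta_mean R M')^T)) *m Z w)) => //.
  + by move=> M'; apply: measurable_cV_coor; exact: measurable_mulmx.
  + by move=> M'; exact: measurable_mulmx.
  + by move=> g mg; exact: (mean_graph_null mZ hsigma hZ hM0 mg).
- apply: (cond_pvalue_uniform (M := M)
    (T := fun M' w => sigma^-1 * euclidean_norm (projection_global R M' *m Z w))
    (Q := fun M' w =>
      ((sigma / euclidean_norm (projection_global R M' *m Z w)) *:
         (projection_global R M' *m Z w),
       (1%:M - projection_global R M') *m Z w))) => //.
  + move=> M'.
    exact: (measurableT_comp (measurable_global_statistic_region sigma M') mZ).
  + move=> M'.
    exact: (measurableT_comp (measurable_global_nuisance_region sigma M') mZ).
  + by move=> g mg; exact: (global_graph_null mZ hsigma hZ hM0 mg).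
Qed.
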